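(* Let $L_1,L_2>0$, $\Delta>0$, $d\ge 1$, and let $f\colon\mathbb{R}^d\to\mathbb{R}$ be twice differentiable with $L_1$-Lipschitz gradient and $L_2$-Lipschitz Hessian. There is a method which, given any $x^{(0)}\in\mathbb{R}^d$ with $\Delta$-bounded sub-optimality with respect to $f$ and any $0<\epsilon\le\min\{L_1^2L_2^{-1},\Delta^{2/3}L_2^{1/3}\}$, outputs an $\epsilon$-critical point of $f$ with at most $$\tilde O\left(d^{1/3}L_2^{1/2}\Delta\epsilon^{-3/2}+d\right)$$ queries to a gradient oracle for $f$.
   Context: $\|\cdot\|$ is the Euclidean norm on vectors and the $\ell_2$-operator norm on matrices. The gradient is $L_1$-Lipschitz if $\|\nabla f(x)-\nabla f(y)\|\le L_1\|x-y\|$ for all $x,y$; the Hessian is $L_2$-Lipschitz if $\|\nabla^2 f(x)-\nabla^2 f(y)\|\le L_2\|x-y\|$ for all $x,y$. A point $x$ is $\epsilon$-critical for $f$ if $\|\nabla f(x)\|\le\epsilon$. A point $x^{(0)}$ has $\Delta$-bounded sub-optimality with respect to $f$ if $f(x^{(0)})-\inf_{x\in\mathbb{R}^d}f(x)\le\Delta$. A gradient oracle for $f$ outputs $\nabla f(x)$ when queried at $x\in\mathbb{R}^d$. The method accesses $f$ only through the gradient oracle and is given the parameters $L_1,L_2,\Delta,\epsilon$. $\tilde O(\cdot)$ hides universal constants and factors polylogarithmic in $\max\{L_2,L_2^{-1}\}$, $\max\{\Delta,\Delta^{-1}\}$ and $\max\{\epsilon,\epsilon^{-1}\}$. *)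

(* Defs.v *)
From mathcomp Require Import all_boot all_order all_algebra.
From mathcomp Require Import all_classical all_reals all_analysis.
Import Order.TTheory GRing.Theory Num.Theory.
Import numFieldNormedType.Exports.

Set Implicit Arguments.
Unset Strict Implicit.
Unset Printing Implicit Defensive.

Local Open Scope classical_set_scope.
Local Open Scope ring_scope.

(* Vectors of R^d are row vectors.  The library norm on matrices is the max
   norm; it is used only through the topology underlying [differentiable]. *)

Definition enorm (R : realType) (d : nat) (x : 'rV[R]_d) : R :=
  Num.sqrt (\sum_(i < d) x 0 i ^+ 2).

(* Row-vector convention: A acts by v |-> v *m A.  The supremum is over a
   nonempty bounded set, so the real-valued [sup] is the true supremum. *)
Definition opnorm (R : realType) (d : nat) (A : 'M[R]_d) : R :=
  sup [set enorm (v *m A) | v in [set v : 'rV[R]_d | enorm v <= 1]].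

Definition gradient (R : realType) (d : nat) (f : 'rV[R]_d -> R)
    (x : 'rV[R]_d) : 'rV[R]_d :=
  \row_(i < d) 'D_(delta_mx 0 i) f x.

Definition hessian (R : realType) (d : nat) (f : 'rV[R]_d -> R)
    (x : 'rV[R]_d) : 'M[R]_d :=
  jacobian (gradient f) x.

Definition twice_differentiable (R : realType) (d : nat)
    (f : 'rV[R]_d -> R) : Prop :=
  (forall x, differentiable f x) /\ (forall x, differentiable (gradient f) x).

Definition gradient_lipschitz (R : realType) (d : nat) (L : R)
    (f : 'rV[R]_d -> R) : Prop :=
  forall x y, enorm (gradient f x - gradient f y) <= L * enorm (x - y).

Definition hessian_lipschitz (R : realType) (d : nat) (L : R)
    (f : 'rV[R]_d -> R) : Prop :=
  forall x y, opnorm (hessian f x - hessian f y) <= L * enorm (x - y).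

Definition critical (R : realType) (d : nat) (eps : R) (f : 'rV[R]_d -> R)
    (x : 'rV[R]_d) : Prop :=
  enorm (gradient f x) <= eps.

(* The infimum is taken in the extended reals: the condition fails when f is
   unbounded below. *)
Definition bounded_suboptimality (R : realType) (d : nat) (Delta : R)
    (f : 'rV[R]_d -> R) (x0 : 'rV[R]_d) : Prop :=
  ((f x0)%:E - ereal_inf (range (EFin \o f)) <= Delta%:E)%E.

(* A deterministic adaptive method: it either stops with an output point, or
   queries the oracle at a point and continues with a method that depends on
   the answer.  The function being minimized can influence the run only
   through the answers.  Computation between queries is unrestricted, as only
   queries are counted.  Methods are well-founded trees, hence terminate
   against every oracle. *)
Inductive oracle_method (V : Type) : Type :=
| Output of V
| Query of V & (V -> oracle_method V).

Fixpoint output (V : Type) (oracle : V -> V) (m : oracle_method V) : V :=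
  match m with
  | Output x => x
  | Query x next => output oracle (next (oracle x))
  end.

Fixpoint queries (V : Type) (oracle : V -> V) (m : oracle_method V) : nat :=
  match m with
  | Output _ => 0%N
  | Query x next => (queries oracle (next (oracle x))).+1
  end.

(* The summand 1 makes [log_size] positive at t = 1; every polynomial in the
   logarithms ln (max (t, 1/t)), t = L2, Delta, eps, is bounded by a constant
   multiple of [polylog k L2 Delta eps] for some k. *)
Definition log_size (R : realType) (t : R) : R := 1 + ln (Num.max t t^-1).

Definition polylog (R : realType) (k : nat) (L2 Delta eps : R) : R :=
  (log_size L2 * log_size Delta * log_size eps) ^+ k.

(* Main.v *)
(* Fix the radius rho = sqrt(eps / L2) / 50 and K ~ d^(1/3).  A Hessian H
   estimated at z by d gradient differences stays within
   l = 128 L2 rho K^2 of the true Hessians on a ball of radius 64 rho K^2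
   around z, so H can serve for 32 K^2 steps of length at most 2 rho.  Each step
   decreases f by at least L2 rho^3 and costs O(K) gradients: with the
   preconditioner M = H + 3 l, run accelerated gradient descent with friction
   1/K for at most K iterations.  While f has no strongly negative curvature
   along the steps, the energy f + |step|_M^2 / 2 decreases by |step|_M^2 / (8K)
   per iteration, up to the error of the quadratic model.  Either the steps add
   up to a sufficient decrease; or a step has negative curvature, and moving
   along it decreases f; or all K iterates stay close to the start, and then the
   preconditioned gradients telescope, so that a weighted average of the
   iterates is eps-critical.
   An epoch (one Hessian and its 32 K^2 steps) costs O(d) gradients, and by
   Delta-bounded sub-optimality there are at most Delta / (32 K^2 L2 rho^3) + 1
   of them.  No logarithm is lost. *)
From HB Require Import structures.
Require Import Defs.
From mathcomp Require Import all_boot all_order all_algebra.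
From mathcomp Require Import all_classical all_reals all_analysis.
From mathcomp Require Import ring lra.
Import Order.TTheory GRing.Theory Num.Theory.
Import numFieldNormedType.Exports.
Local Open Scope ring_scope.

Set Implicit Arguments.
Unset Strict Implicit.
Unset Printing Implicit Defensive.

(* Locking keeps [ring] and [lra] from comparing atoms by unfolding matrix
   products. *)
HB.lock Definition dot (R : realType) (d : nat) (u v : 'rV[R]_d) : R :=
  (u *m v^T) 0 0.

(** * Quadratic forms, the norm of a semidefinite matrix, the Euclidean norm *)

Section QuadraticForms.
Context {R : realType} {d : nat}.
Implicit Types (u v w : 'rV[R]_d) (M : 'M[R]_d).

Lemma dotE u v : dot u v = \sum_i u 0 i * v 0 i.
Proof. by rewrite dot.unlock mxE; apply: eq_bigr => i _; rewrite mxE. Qed.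

Lemma dotC u v : dot u v = dot v u.
Proof. by rewrite !dotE; apply: eq_bigr => i _; rewrite mulrC. Qed.

Lemma dotDl u v w : dot (u + v) w = dot u w + dot v w.
Proof. by rewrite dot.unlock mulmxDl mxE. Qed.

Lemma dotZl a u w : dot (a *: u) w = a * dot u w.
Proof. by rewrite dot.unlock -scalemxAl mxE. Qed.

Lemma dotDr u v w : dot w (u + v) = dot w u + dot w v.
Proof. by rewrite !(dotC w) dotDl. Qed.

Lemma dotZr a u w : dot w (a *: u) = a * dot w u.
Proof. by rewrite !(dotC w) dotZl. Qed.

Lemma dotNl u w : dot (- u) w = - dot u w.
Proof. by rewrite -scaleN1r dotZl mulN1r. Qed.

Lemma dotNr u w : dot w (- u) = - dot w u.
Proof. by rewrite !(dotC w) dotNl. Qed.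

Lemma dot0l w : dot 0 w = 0.
Proof. by rewrite -[X in dot X _](scale0r 0) dotZl mul0r. Qed.

Lemma dot0r w : dot w 0 = 0.
Proof. by rewrite dotC dot0l. Qed.

Lemma dot_ge0 u : 0 <= dot u u.
Proof. by rewrite dotE sumr_ge0// => i _; rewrite -expr2 sqr_ge0. Qed.

Lemma dot_eq0 u : dot u u = 0 -> u = 0.
Proof.
rewrite dotE => /eqP; rewrite psumr_eq0 => [/allP u0|i _]; last first.
  by rewrite -expr2 sqr_ge0.
apply/rowP => i; rewrite mxE; apply/eqP.
by have := u0 i (mem_index_enum i); rewrite -expr2 sqrf_eq0.
Qed.

Lemma dot_mulmx u v M : dot (u *m M) v = dot u (v *m M^T).
Proof. by rewrite dot.unlock trmx_mul trmxK mulmxA. Qed.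

Definition bilinE := (mulmxDl, mulmxDr, mulmxN, mulNmx, =^~ scalemxAl,
  =^~ scalemxAr, mul_mx_scalar, dotDl, dotDr, dotZl, dotZr, dotNl, dotNr).

Lemma dot_symC M u v : M^T = M -> dot (u *m M) v = dot (v *m M) u.
Proof. by move=> MT; rewrite dot_mulmx MT dotC. Qed.

Definition psd M := M^T = M /\ forall u, 0 <= dot (u *m M) u.

Lemma psd1 : psd 1%:M.
Proof. by split=> [|u]; rewrite ?trmx1// mulmx1 dot_ge0. Qed.

(** The form is nonnegative at [u + t *: v] for every [t]; for [c > 0] the minimizer [t = - b / c]
    gives the claim. *)
Lemma psd_cauchy M u v : psd M ->
  dot (u *m M) v ^+ 2 <= dot (u *m M) u * dot (v *m M) v.
Proof.
move=> [MT M0].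
set a := dot (u *m M) u; set b := dot (u *m M) v; set c := dot (v *m M) v.
have q t : 0 <= a + 2 * t * b + t ^+ 2 * c.
  have := M0 (u + t *: v); rewrite !bilinE -/a -/b -/c.
  by rewrite (dot_symC v u MT) -/b; lra.
have a0 : 0 <= a by exact: M0.
have : 0 <= c by exact: M0.
rewrite le_eqVlt => /orP[/eqP c0|c0].
  have [->|bn0] := eqVneq b 0; first by rewrite -c0; lra.
  (* With [c = 0] the quadratic is affine in [t]; this [t] would give it the value -1. *)
  have := q (- (a + 1) / (2 * b)); rewrite -c0.
  have -> : a + 2 * (- (a + 1) / (2 * b)) * b +
     (- (a + 1) / (2 * b)) ^+ 2 * 0 = -1 by field.
  by lra.
have := q (- b / c).
have -> : a + 2 * (- b / c) * b + (- b / c) ^+ 2 * c = (a * c - b ^+ 2) / c.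
  by field; rewrite gt_eqF.
by rewrite pmulr_lge0 ?invr_gt0// subr_ge0.
Qed.

Definition mnorm M u := Num.sqrt (dot (u *m M) u).

Lemma mnorm_ge0 M u : 0 <= mnorm M u. Proof. exact: sqrtr_ge0. Qed.

Lemma sqr_mnorm M u : psd M -> mnorm M u ^+ 2 = dot (u *m M) u.
Proof. by move=> [_ M0]; rewrite sqr_sqrtr. Qed.

Lemma mnormZ M t u : mnorm M (t *: u) = `|t| * mnorm M u.
Proof.
by rewrite /mnorm !bilinE mulrA -expr2 sqrtrM ?sqr_ge0// sqrtr_sqr.
Qed.

Lemma mnormN M u : mnorm M (- u) = mnorm M u.
Proof. by rewrite -scaleN1r mnormZ normrN1 mul1r. Qed.

Lemma mnorm0 M : mnorm M 0 = 0.
Proof. by rewrite -[X in mnorm _ X](scale0r 0) mnormZ normr0 mul0r. Qed.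

Lemma psd_cauchy_norm M u v : psd M ->
  `|dot (u *m M) v| <= mnorm M u * mnorm M v.
Proof.
move=> pM; rewrite -sqrtr_sqr -sqrtrM; last by have [_] := pM; apply.
by rewrite ler_wsqrtr// psd_cauchy.
Qed.

Lemma ler_mnormD M u v : psd M -> mnorm M (u + v) <= mnorm M u + mnorm M v.
Proof.
move=> pM; rewrite -(@ler_pXn2r _ 2) ?nnegrE ?addr_ge0 ?mnorm_ge0//.
have := psd_cauchy_norm u v pM; rewrite ler_norml => /andP[_].
rewrite sqrrD !sqr_mnorm// !bilinE (dot_symC v u pM.1) mulr2n => h.
by lra.
Qed.

Lemma ler_mnormB M u v : psd M -> mnorm M (u - v) <= mnorm M u + mnorm M v.
Proof. by move=> pM; rewrite -(mnormN M v) ler_mnormD. Qed.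

Lemma mnorm_le M u b : psd M -> 0 <= b -> dot (u *m M) u <= b ^+ 2 ->
  mnorm M u <= b.
Proof. by move=> pM b0; rewrite -sqr_mnorm// ler_pXn2r// nnegrE mnorm_ge0. Qed.

Lemma enormE u : enorm u = mnorm 1%:M u.
Proof. by rewrite /enorm /mnorm mulmx1 dotE; congr Num.sqrt. Qed.

Lemma enorm_ge0 u : 0 <= enorm u. Proof. exact: sqrtr_ge0. Qed.

Lemma sqr_enorm u : enorm u ^+ 2 = dot u u.
Proof. by rewrite enormE sqr_mnorm ?mulmx1//; exact: psd1. Qed.

Lemma enormZ t u : enorm (t *: u) = `|t| * enorm u.
Proof. by rewrite !enormE mnormZ. Qed.

Lemma enormN u : enorm (- u) = enorm u.
Proof. by rewrite !enormE mnormN. Qed.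

Lemma enorm0 : enorm (0 : 'rV[R]_d) = 0.
Proof. by rewrite enormE mnorm0. Qed.

Lemma enorm_eq0 u : enorm u = 0 -> u = 0.
Proof. by move=> u0; apply: dot_eq0; rewrite -sqr_enorm u0 expr0n. Qed.

Lemma ler_enormD u v : enorm (u + v) <= enorm u + enorm v.
Proof. by rewrite !enormE ler_mnormD//; exact: psd1. Qed.

Lemma ler_enormB u v : enorm (u - v) <= enorm u + enorm v.
Proof. by rewrite !enormE ler_mnormB//; exact: psd1. Qed.

Lemma enorm_cauchy u v : `|dot u v| <= enorm u * enorm v.
Proof. by have := psd_cauchy_norm u v psd1; rewrite mulmx1 !enormE. Qed.

(** Testing with [w = u] suffices. This reduces vector bounds to scalar ones, to which the mean
    value theorem applies. *)
Lemma enorm_le_dot u c : 0 <= c ->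
  (forall w, dot u w <= c * enorm w) -> enorm u <= c.
Proof.
move=> c0 /(_ u); rewrite -sqr_enorm expr2.
have := enorm_ge0 u; rewrite le_eqVlt => /orP[/eqP <-//|u0].
by rewrite ler_pM2r.
Qed.

Lemma normr_le_enorm u i : `|u 0 i| <= enorm u.
Proof.
rewrite -sqrtr_sqr ler_wsqrtr// (bigD1 i)//= lerDl.
by rewrite sumr_ge0// => j _; rewrite sqr_ge0.
Qed.

Lemma enorm_delta i : enorm (delta_mx 0 i : 'rV[R]_d) = 1.
Proof.
rewrite /enorm (bigD1 i)//= big1 ?addr0 => [|j ji].
  by rewrite mxE !eqxx expr1n sqrtr1.
by rewrite mxE eqxx (negbTE ji) expr0n.
Qed.

End QuadraticForms.

(** * Taylor bounds from the Lipschitz Hessian, and symmetry of the Hessian *)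

Section Taylor.
Context {R : realType}.

Lemma enorm_sum d n (F : 'I_n -> 'rV[R]_d) :
  enorm (\sum_i F i) <= \sum_i enorm (F i).
Proof.
elim/big_ind2 : _ => [|x a y b xa yb|//]; first by rewrite enorm0.
by rewrite (le_trans (ler_enormD _ _))// lerD.
Qed.

Lemma enorm_mulmx_le d (v : 'rV[R]_d) (A : 'M[R]_d) :
  enorm (v *m A) <= enorm v * \sum_i enorm (row i A).
Proof.
rewrite mulmx_sum_row (le_trans (enorm_sum _))// mulr_sumr ler_sum// => i _.
by rewrite enormZ ler_wpM2r ?enorm_ge0 ?normr_le_enorm.
Qed.

(** The row norms bound the set under the supremum, so [sup] is an upper bound of it; a nonzero [v]
    is then normalized. *)
Lemma opnorm_ub d (v : 'rV[R]_d) (A : 'M[R]_d) :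
  enorm (v *m A) <= opnorm A * enorm v.
Proof.
have hs : has_sup [set enorm (w *m A) | w in [set w : 'rV[R]_d | enorm w <= 1]]%classic.
  split; first by exists (enorm (0 *m A)), 0; rewrite //= enorm0.
  exists (\sum_i enorm (row i A)) => _ [w /= w1 <-].
  rewrite (le_trans (enorm_mulmx_le _ _))// ler_piMl// sumr_ge0// => i _.
  exact: enorm_ge0.
have := enorm_ge0 v; rewrite le_eqVlt => /orP[/eqP v0|v0].
  by rewrite -v0 (enorm_eq0 (esym v0)) mul0mx enorm0 mulr0.
rewrite -ler_pdivrMr// mulrC.
have -> : (enorm v)^-1 * enorm (v *m A) = enorm (((enorm v)^-1 *: v) *m A).
  by rewrite -scalemxAl enormZ ger0_norm// invr_ge0 ltW.
apply: (ub_le_sup hs.2); exists ((enorm v)^-1 *: v) => //=.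
by rewrite enormZ ger0_norm ?invr_ge0 ?(ltW v0)// mulVf// gt_eqF.
Qed.

Lemma is_derive_line (V W : normedModType R) (F : V -> W) x u (t : R) :
  differentiable F (x + t *: u) ->
  is_derive t 1 (fun s : R => F (x + s *: u)) ('D_u F (x + t *: u)).
Proof.
move=> dF; have lin : is_diff t (fun s : R => x + s *: u) (fun s : R => s *: u).
  have := is_diffD (is_diff_cst x t) (is_diff_scalel t u).
  by rewrite add0r.
have /= dc := is_diff_comp lin (differentiableP dF).
have dd : differentiable (F \o (fun s : R => x + s *: u)) t by [].
apply: DeriveDef; first exact: diff_derivable.
by rewrite deriveE// diff_val /= scale1r -deriveE.
Qed.

Lemma mean_value_bound (g dg : R -> R) (c : R) :
  (forall t : R, is_derive t 1 g (dg t)) ->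
  (forall t : R, 0 <= t <= 1 -> `|dg t| <= c) -> `|g 1 - g 0| <= c.
Proof.
move=> gd gc.
have cg : {within `[0, 1], continuous g}%classic.
  apply: continuous_subspaceT => t.
  by apply/differentiable_continuous/derivable1_diffP; have [] := gd t.
have [t /itvP t01 ->] := MVT ltr01 (fun t _ => gd t) cg.
by rewrite subr0 mulr1 gc// !t01.
Qed.

Variables (d : nat) (f : 'rV[R]_d -> R) (L2 : R).
Hypothesis L20 : 0 < L2.
Hypothesis f2 : twice_differentiable f.
Hypothesis fL2 : hessian_lipschitz L2 f.

Lemma deriveE_gradient x u : 'D_u f x = dot (gradient f x) u.
Proof.
rewrite deriveE; last exact: f2.1.
rewrite [X in 'd f x X]row_sum_delta linear_sum dotE.
by apply: eq_bigr => i _; rewrite linearZ/= mxE deriveE 1?mulrC//; exact: f2.1.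
Qed.

Lemma is_derive_dot_gradient x u w (t : R) :
  is_derive t 1 (fun s : R => dot (gradient f (x + s *: u)) w)
    (dot (u *m hessian f (x + t *: u)) w).
Proof.
have dG := is_derive_line (f2.2 (x + t *: u)).
rewrite (deriveEjacobian _ (f2.2 _)) in dG.
have dGi i : is_derive t 1 (fun s : R => gradient f (x + s *: u) 0 i)
    ((u *m hessian f (x + t *: u)) 0 i).
  apply: DeriveDef; first by have [/derivable_mxP + _] := dG; apply.
  have [dr e] := dG; move: e; rewrite derive_mx// => /rowP/(_ i).
  by rewrite mxE.
have -> : (fun s : R => dot (gradient f (x + s *: u)) w) =
    \sum_i (w 0 i \*: fun s : R => gradient f (x + s *: u) 0 i).
  apply/funext => s; rewrite fct_sumE dotE.
  by apply: eq_bigr => i _; rewrite /= mulrC.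
rewrite dotE.
have -> : \sum_i (u *m hessian f (x + t *: u)) 0 i * w 0 i =
    \sum_i w 0 i *: (u *m hessian f (x + t *: u)) 0 i.
  by apply: eq_bigr => i _; rewrite mulrC.
by apply: is_derive_sum => i; exact: is_deriveZ.
Qed.

(** The mean value theorem is applied to the remainder paired with a fixed [w]. It replaces
    integration, which is why the constant is 1 and not 1/2. *)
Lemma gradient_taylor x u :
  enorm (gradient f (x + u) - gradient f x - u *m hessian f x) <=
  L2 * enorm u ^+ 2.
Proof.
have L20' : 0 <= L2 * enorm u ^+ 2 by rewrite mulr_ge0 ?sqr_ge0// ltW.
apply: enorm_le_dot => // w.
pose g (t : R) := dot (gradient f (x + t *: u)) w - t * dot (u *m hessian f x) w.
pose dg (t : R) := dot (u *m (hessian f (x + t *: u) - hessian f x)) w.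
have gd (t : R) : is_derive t 1 g (dg t).
  have -> : g = (fun t => dot (gradient f (x + t *: u)) w) - 
     (dot (u *m hessian f x) w \*: id).
    by apply/funext => s; rewrite /g/= [s * _]mulrC.
  rewrite /dg mulmxBr dotDl dotNl.
  have dl := is_derive_dot_gradient x u w t.
  apply: (is_derive_eq (is_deriveB dl (is_deriveZ _ (is_derive_id t (1 : R))))).
  by rewrite /GRing.scale/= mulr1.
have := @mean_value_bound g dg (L2 * enorm u ^+ 2 * enorm w) gd.
rewrite /g scale1r scale0r addr0 mul1r mul0r subr0 -!dotNl -!dotDl => H.
rewrite -[in X in dot X w]addrA [- _ - _]addrC addrA (le_trans (ler_norm _))// H//.
move=> t /andP[t0 t1].
rewrite (le_trans (enorm_cauchy _ _))// ler_wpM2r ?enorm_ge0//.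
rewrite (le_trans (opnorm_ub _ _))// expr2 mulrA ler_wpM2r ?enorm_ge0//.
rewrite (le_trans (fL2 _ _))//.
rewrite addrAC subrr add0r enormZ ger0_norm// mulrCA ler_piMl//.
by rewrite mulr_ge0 ?enorm_ge0// ltW.
Qed.

(** The derivative of the remainder along the segment is the remainder of [gradient_taylor] at
    [t *: u], paired with [u]. *)
Lemma taylor2 x u :
  `|f (x + u) - f x - dot (gradient f x) u - 2^-1 * dot (u *m hessian f x) u|
  <= L2 * enorm u ^+ 3.
Proof.
set J := hessian f x; set G := gradient f x.
pose g (t : R) := f (x + t *: u) - t * dot G u - t ^+ 2 * (2^-1 * dot (u *m J) u).
pose dg (t : R) := dot (gradient f (x + t *: u) - G - (t *: u) *m J) u.
have gd (t : R) : is_derive t 1 g (dg t).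
  have -> : g = (fun t => f (x + t *: u)) - (dot G u \*: id)
     - ((2^-1 * dot (u *m J) u) \*: (id ^+ 2)).
    by apply/funext => s; rewrite /g/= [s * _]mulrC [s ^+ 2 * _]mulrC.
  have d1 := is_derive_line (f2.1 (x + t *: u)).
  rewrite deriveE_gradient in d1.
  have d2 := is_deriveZ (dot G u) (is_derive_id t (1 : R)).
  have d3 := is_deriveZ (2^-1 * dot (u *m J) u)
     (is_deriveX 2 (is_derive_id t (1 : R))).
  apply: (is_derive_eq (is_deriveB (is_deriveB d1 d2) d3)).
  by rewrite /dg !bilinE /GRing.scale/=; field.
have := @mean_value_bound g dg (L2 * enorm u ^+ 3) gd.
rewrite /g scale1r scale0r addr0 expr1n expr0n !mul1r !mul0r !subr0.
have -> : forall a b c e : R, a - b - c - e = a - e - b - c.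
  by move=> *; ring.
apply=> t /andP[t0 t1].
rewrite (le_trans (enorm_cauchy _ _))// exprS mulrCA mulrC.
rewrite ler_wpM2l ?enorm_ge0// (le_trans (gradient_taylor _ _))//.
rewrite ler_wpM2l ?(ltW L20)// enormZ exprMn ger0_norm// ler_piMl ?sqr_ge0//.
by rewrite expr_le1.
Qed.

(* Compare two expansions of [f (x + u + v)]: from [x] along [u + v], and from
   [x + u] along [v]. *)
Lemma hessian_asym_bound x u v :
  `|dot (v *m hessian f x) u - dot (u *m hessian f x) v| <=
  4 * L2 * (enorm u + enorm v) ^+ 3.
Proof.
have h1 := taylor2 x u; have h2 := taylor2 x (u + v).
have h3 := taylor2 (x + u) v.
have h4 : `|dot (gradient f (x + u) - gradient f x - u *m hessian f x) v| <=
    L2 * enorm u ^+ 2 * enorm v.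
  rewrite (le_trans (enorm_cauchy _ _))// ler_wpM2r ?enorm_ge0//.
  exact: gradient_taylor.
have h5 : `|dot (v *m (hessian f (x + u) - hessian f x)) v| <=
    L2 * enorm u * enorm v ^+ 2.
  rewrite (le_trans (enorm_cauchy _ _))// [X in _ <= _ * X]expr2 mulrA.
  rewrite ler_wpM2r ?enorm_ge0// (le_trans (opnorm_ub _ _))//.
  rewrite ler_wpM2r ?enorm_ge0// (le_trans (fL2 _ _))//.
  by rewrite addrAC subrr add0r.
have p0 := enorm_ge0 u; have q0 := enorm_ge0 v.
have h6 : L2 * enorm (u + v) ^+ 3 <= L2 * (enorm u + enorm v) ^+ 3.
  rewrite ler_wpM2l ?(ltW L20)// ler_pXn2r ?nnegrE ?enorm_ge0 ?addr_ge0//.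
  exact: ler_enormD.
rewrite addrA in h2.
have e : L2 * (enorm u + enorm v) ^+ 3 = L2 * enorm u ^+ 3 + L2 * enorm v ^+ 3 +
    3 * (L2 * enorm u ^+ 2 * enorm v) + 3 * (L2 * enorm u * enorm v ^+ 2).
  by ring.
have a0 : 0 <= L2 * enorm u ^+ 2 * enorm v by rewrite !mulr_ge0// ltW.
have b0 : 0 <= L2 * enorm u * enorm v ^+ 2 by rewrite !mulr_ge0 ?exprn_ge0// ltW.
rewrite -mulrA; move: h1 h2 h3 h4 h5 h6 e a0 b0.
set r1 := (X in `|X| <= _ -> _); set r2 := (X in _ -> `|X| <= _ -> _).
set r3 := (X in _ -> _ -> `|X| <= _ -> _).
set r4 := (X in _ -> _ -> _ -> `|X| <= _ -> _).
set r5 := (X in _ -> _ -> _ -> _ -> `|X| <= _ -> _).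
(* In this combination of the remainders all values of [f], all gradients and the Hessian at [x + u]
   cancel. *)
have -> : dot (v *m hessian f x) u - dot (u *m hessian f x) v =
    2 * (r1 + r3 + r4 + 2^-1 * r5 - r2).
  rewrite /r1 /r2 /r3 /r4 /r5.
  move: (f (x + u + v)) (f (x + u)) (f x) (gradient f (x + u)) (gradient f x)
    (hessian f (x + u)) (hessian f x) => ? ? ? ? ? H' H.
  by rewrite mulmxBr !bilinE; field.
move: r1 r2 r3 r4 r5 (L2 * enorm u ^+ 3) (L2 * enorm v ^+ 3)
  (L2 * enorm (u + v) ^+ 3) (L2 * (enorm u + enorm v) ^+ 3)
  (L2 * enorm u ^+ 2 * enorm v) (L2 * enorm u * enorm v ^+ 2).
move=> r1 r2 r3 r4 r5 ? ? ? ? ? ?.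
rewrite !ler_norml => /andP[? ?] /andP[? ?] /andP[? ?] /andP[? ?] /andP[? ?] ? ? ? ?.
by apply/andP; split; lra.
Qed.

(** When [u] and [v] are scaled by [t], the asymmetry scales as [t ^+ 2] but its bound as [t ^+ 3];
    small [t] forces the asymmetry to vanish. *)
Lemma hessian_sym x : (hessian f x)^T = hessian f x.
Proof.
set J := hessian f x.
suff sym u v : dot (u *m J) v = dot (v *m J) u.
  have e (w : 'rV[R]_d) i : dot w (delta_mx 0 i) = w 0 i.
    by rewrite dot.unlock trmx_delta -colE mxE.
  apply/matrixP => i j; rewrite mxE.
  by have := sym (delta_mx 0 j) (delta_mx 0 i); rewrite !e -!rowE !mxE.
apply/eqP; rewrite -subr_eq0 -normr_le0; apply/ler_addgt0Pr => e e0.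
rewrite add0r distrC; set D := `|_|.
set c := 4 * L2 * (enorm u + enorm v) ^+ 3.
have c0 : 0 <= c.
  by rewrite !mulr_ge0 ?exprn_ge0 ?addr_ge0 ?enorm_ge0 ?(ltW L20).
(* This gives [t * c <= e]; the summand 1 covers [c = 0]. *)
set t := e / (c + 1); have t0 : 0 < t by rewrite divr_gt0//; lra.
have := hessian_asym_bound x (t *: u) (t *: v); rewrite -/J !bilinE.
have -> : t * (t * dot (v *m J) u) - t * (t * dot (u *m J) v) =
  t ^+ 2 * (dot (v *m J) u - dot (u *m J) v) by ring.
rewrite normrM (ger0_norm (sqr_ge0 t)) -/D !enormZ (ger0_norm (ltW t0)).
rewrite -mulrDr.
have -> : 4 * L2 * (t * (enorm u + enorm v)) ^+ 3 = t ^+ 2 * (t * c).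
  by rewrite /c; ring.
rewrite ler_pM2l ?exprn_gt0// => /le_trans; apply.
by rewrite /t mulrAC ler_pdivrMr ?ler_pM2l//; lra.
Qed.

End Taylor.

(** * The quadratic model and the energy decrease of one accelerated step *)

Section QuadraticModel.
Context {R : realType} {d : nat}.
Implicit Types (u v s a c g : 'rV[R]_d).

Definition model g (A : 'M[R]_d) s : R := dot g s + 2^-1 * dot (s *m A) s.

Variables (A M : 'M[R]_d) (l : R).
Hypotheses (AT : A^T = A) (pM : psd M) (pMA : psd (M - A)) (l0 : 0 < l).
Hypothesis lM : forall u, l * dot u u <= dot (u *m M) u.

Lemma enorm_le_mnorm u : Num.sqrt l * enorm u <= mnorm M u.
Proof.
rewrite -(@ler_pXn2r _ 2) ?nnegrE ?mulr_ge0 ?sqrtr_ge0 ?mnorm_ge0//.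
by rewrite exprMn sqr_sqrtr ?(ltW l0)// sqr_enorm sqr_mnorm.
Qed.

(** Turns bounds by multiples of [radius] in the [M]-norm into Euclidean bounds by multiples of
    [rho]. *)
Lemma enorm_le_of_mnorm u r : mnorm M u <= Num.sqrt l * r -> enorm u <= r.
Proof.
by move=> /(le_trans (enorm_le_mnorm u)); rewrite ler_pM2l// sqrtr_gt0.
Qed.

Lemma mulmx_invK u : u *m invmx M *m M = u.
Proof.
rewrite mulmxKV// -row_free_unit -kermx_eq0; apply/rowV0P => v /sub_kermxP vM.
apply: dot_eq0; apply/eqP; rewrite eq_le dot_ge0 andbT.
by have := lM v; rewrite vM dot0l pmulr_rle0.
Qed.

(* [c] is the accelerated step and [c'] its truncation.  The [M]-inner product
   splits as [A] plus the nonnegative [M - A], and the cross term in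
   [M - A] is absorbed by Young's inequality. *)
Lemma energy_step g s a c c' G (th t e : R) :
  0 < th -> th <= 1 -> 0 <= t <= 1 ->
  enorm (G - g - (s + (1 - th) *: a) *m A) <= e ->
  c = (1 - th) *: a - G *m invmx M ->
  - (th / 2) * dot (a *m M) a <= dot (a *m A) a ->
  c' = t *: c ->
  model g A (s + c') + 2^-1 * dot (c' *m M) c' <=
  model g A s + 2^-1 * dot (a *m M) a - th / 4 * dot (a *m M) a
  + th / 8 * dot (c' *m M) c' + 2 / (th * l) * e ^+ 2.
Proof.
move=> th0 th1 /andP[t0 t1] He Hc Hcurv Hc'.
have [de HG {}He] : exists2 de,
    G = g + (s + (1 - th) *: a) *m A + de & enorm de <= e.
  by exists (G - g - (s + (1 - th) *: a) *m A);
    rewrite // -[G - g - _]addrA -opprD [RHS]addrC subrK.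
have cM : dot (c *m M) c' = (1 - th) * dot (a *m M) c' - dot G c'.
  by rewrite Hc mulmxBl mulmx_invK !bilinE.
rewrite HG !bilinE in cM.
have cc' : dot (c' *m M) c' <= dot (c *m M) c'.
  rewrite Hc' !bilinE ler_wpM2l//.
  by rewrite ler_piMl// pM.2.
have young : dot (a *m M) c' - dot (a *m A) c' <=
   2^-1 * (dot (a *m M) a - dot (a *m A) a) +
   2^-1 * (dot (c' *m M) c' - dot (c' *m A) c').
  have := pMA.2 (a - c'); rewrite !bilinE.
  rewrite (dot_symC c' a pM.1) (dot_symC c' a AT); lra.
have MAc : 0 <= dot (c' *m M) c' - dot (c' *m A) c'.
  by have := pMA.2 c'; rewrite !bilinE.
have noise : - dot de c' <=
    th / 8 * dot (c' *m M) c' + 2 / (th * l) * e ^+ 2.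
  have h1 : - dot de c' <= e * enorm c'.
    have := enorm_cauchy de c'; rewrite ler_norml => /andP[h _].
    have := ler_wpM2r (enorm_ge0 c') He; lra.
  have h2 := lM c'; rewrite -sqr_enorm in h2.
  have h3 : th / 8 * (l * enorm c' ^+ 2) <= th / 8 * dot (c' *m M) c'.
    by rewrite ler_wpM2l//; lra.
  have h4 : e * enorm c' <= th / 8 * (l * enorm c' ^+ 2) + 2 / (th * l) * e ^+ 2.
    rewrite -subr_ge0.
    have -> : th / 8 * (l * enorm c' ^+ 2) + 2 / (th * l) * e ^+ 2 - e * enorm c' =
      8^-1 / (th * l) * (th * l * enorm c' - 4 * e) ^+ 2.
      by field; rewrite !gt_eqF.
    by rewrite mulr_ge0 ?sqr_ge0// divr_ge0 ?mulr_ge0// ltW.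
  lra.
have sA : dot (c' *m A) s = dot (s *m A) c' by exact: dot_symC.
rewrite /model !bilinE sA.
have a0 : 0 <= dot (a *m M) a by exact: pM.2.
have c0 : 0 <= dot (c' *m M) c' by exact: pM.2.
move: cM cc' young MAc noise Hcurv a0 c0.
move: (dot (c *m M) c') (dot (a *m M) c') (dot g c') (dot (s *m A) c')
  (dot (a *m A) c') (dot de c') (dot (c' *m M) c') (dot (a *m M) a)
  (dot (a *m A) a) (dot (c' *m A) c') (2 / (th * l) * e ^+ 2)
  => cMc aMc gc sAc aAc dc n' n aAa cAc E.
move=> cM cc' young MAc noise Hcurv n0 n'0.
have h1 : (1 - th) * (aMc - aAc) <=
    (1 - th) * (2^-1 * (n - aAa) + 2^-1 * (n' - cAc)).
  by rewrite ler_wpM2l// subr_ge0.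
(* Friction removes [th / 2] of the squared [M]-norm of [a]; the tolerated negative curvature gives
   back at most [th / 4], which leaves the claimed [th / 4]. *)
have h2 : (1 - th) * (- aAa) <= (1 - th) * (th / 2 * n).
  by rewrite ler_wpM2l ?subr_ge0//; lra.
have h3 : 0 <= th * (n' - cAc) by rewrite mulr_ge0// ltW.
have h4 : 0 <= th ^+ 2 * n by rewrite mulr_ge0// sqr_ge0.
lra.
Qed.

End QuadraticModel.

(** * One phase of the method, in continuation-passing form *)

Section Method.
Context {R : realType} {d : nat}.
Variables (L2 rho : R) (K : nat).
Implicit Types (x g s a p : 'rV[R]_d) (M H : 'M[R]_d)
  (next : 'rV[R]_d -> oracle_method 'rV[R]_d).

(* The constant 128 makes the energy decrease 16 L2 rho^3 dominate the model
   error 8 L2 rho^3 at distance 2 rho. *)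
Definition smoothness : R := 128 * L2 * rho * K%:R ^+ 2.
Definition friction : R := K%:R^-1.
Definition radius : R := Num.sqrt smoothness * rho.

Definition descent_point x g p := if dot g p <= 0 then x + p else x - p.

(* Division by zero makes [rescale 0 = 0]. *)
Definition rescale u : 'rV[R]_d := (rho / enorm u) *: u.

(* Truncation bounds the displacement by [2 * radius] even in the iteration that
   stops the run; it is inactive in all other iterations. *)
Definition clip M s :=
  if mnorm M s <= radius then s else (radius / mnorm M s) *: s.

(* Accelerated gradient descent preconditioned by [M]: [s] is the current
   displacement from [x], [a] the last step, [S] the sum of the squared
   [M]-norms of the steps, and the iterate produced with fuel [k] enters the
   average that is returned with weight [k]. *)
Fixpoint agd x g M next (k : nat) s a (S : R) acc : oracle_method 'rV[R]_d :=
  if k is k'.+1 then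
    let p := rescale a in
    Query (x + p) (fun gp =>
    if dot (gp - g) p < - (friction / 4) * dot (p *m M) p
    then next (descent_point x g p) else
    Query (x + (s + (1 - friction) *: a)) (fun G =>
    let c := clip M ((1 - friction) *: a - G *m invmx M) in
    let S' := S + dot (c *m M) c in
    if friction * radius ^+ 2 <= S' then next (x + (s + c)) else
    agd x g M next k' (s + c) c S' (acc + k%:R *: (s + c))))
  else Output (x + (2 / (K%:R * (K%:R + 1))) *: acc).

(** Searching [H] for a strongly negative direction takes no query, so a choice operator does it. If
    there is none, the default 0 fails the strict test. *)
Definition phase H next x : oracle_method 'rV[R]_d :=
  Query x (fun g =>
  let u := xget 0 [set u | dot (u *m H) u < - (2 * smoothness) * dot u u]%classic in
  if dot (u *m H) u < - (2 * smoothness) * dot u u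
  then next (descent_point x g (rescale u))
  else agd x g (H + (3 * smoothness)%:M) next K 0 0 0 0).

(** Correctness relative to a continuation: the run either ends at a critical point or has the same
    output as [next] started at a better nearby point. In this form guarantees can be chained. *)
Definition advances (f : 'rV[R]_d -> R) (eps p r : R)
    (m : oracle_method 'rV[R]_d) next (n : nat) x :=
  let G := gradient f in
  (critical eps f (output G m) /\ (queries G m <= n)%N) \/
  exists x', [/\ output G m = output G (next x'),
    (queries G m <= n + queries G (next x'))%N,
    f x' <= f x - p & enorm (x' - x) <= r].

End Method.

(** * Analysis of the accelerated run with a fixed preconditioner *)

Section PhaseAnalysis.
Context {R : realType} {d : nat}.
Variables (f : 'rV[R]_d -> R) (L2 rho : R) (K : nat).
Hypotheses (L20 : 0 < L2) (rho0 : 0 < rho) (K0 : (0 < K)%N).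
Hypotheses (f2 : twice_differentiable f) (fL2 : hessian_lipschitz L2 f).
Implicit Types (s a c p u v : 'rV[R]_d)
  (next : 'rV[R]_d -> oracle_method 'rV[R]_d).

Local Notation l := (smoothness L2 rho K).
Local Notation th := (friction K : R).
Local Notation B := (radius L2 rho K).
Local Notation adv := (advances f (2500 * L2 * rho ^+ 2) (L2 * rho ^+ 3) (2 * rho)).

Let K_gt0 : 0 < K%:R :> R. Proof. by rewrite ltr0n. Qed.

Lemma smoothness_gt0 : 0 < l.
Proof. by rewrite /smoothness !mulr_gt0 ?exprn_gt0. Qed.

Lemma friction_gt0 : 0 < th. Proof. by rewrite invr_gt0. Qed.

Lemma friction_le1 : th <= 1.
Proof. by rewrite invf_le1// ler1n. Qed.

Lemma frictionK : th * K%:R = 1.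
Proof. by rewrite mulVf// gt_eqF. Qed.

Lemma radius_gt0 : 0 < B.
Proof. by rewrite mulr_gt0 ?sqrtr_gt0 ?smoothness_gt0. Qed.

Lemma sqr_radius : B ^+ 2 = l * rho ^+ 2.
Proof. by rewrite exprMn sqr_sqrtr// ltW ?smoothness_gt0. Qed.

Lemma friction_smoothness : th ^+ 2 * l = 128 * (L2 * rho).
Proof. by rewrite /friction /smoothness; field; rewrite gt_eqF. Qed.

Lemma rescale_le u : enorm (rescale rho u) <= rho.
Proof.
have := enorm_ge0 u; rewrite le_eqVlt => /orP[/eqP u0|u0].
  by rewrite /rescale (enorm_eq0 (esym u0)) scaler0 enorm0 ltW.
by rewrite enormZ ger0_norm ?divfK ?gt_eqF// divr_ge0 ?ltW.
Qed.

Lemma rescale_norm u : 0 < enorm u -> enorm (rescale rho u) = rho.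
Proof.
by move=> u0; rewrite enormZ ger0_norm ?divfK ?gt_eqF// divr_ge0 ?ltW.
Qed.

(** The sign choice makes the linear term nonpositive. In units of [L2 * rho ^+ 3], the curvature
    term contributes at most -2 and the Taylor remainder at most 1. *)
Lemma descent_pointP x p : enorm p <= rho ->
  dot (p *m hessian f x) p <= - 4 * (L2 * rho ^+ 3) ->
  f (descent_point x (gradient f x) p) <= f x - L2 * rho ^+ 3 /\
  enorm (descent_point x (gradient f x) p - x) <= 2 * rho.
Proof.
move=> pr curv.
have main q : enorm q <= rho -> dot (gradient f x) q <= 0 ->
    dot (q *m hessian f x) q <= - 4 * (L2 * rho ^+ 3) ->
    f (x + q) <= f x - L2 * rho ^+ 3 /\ enorm (x + q - x) <= 2 * rho.
  move=> qr gq cq; split; last first.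
    by rewrite addrAC subrr add0r (le_trans qr)// ler_peMl ?(ltW rho0)// ler1n.
  have := taylor2 L20 f2 fL2 x q; rewrite ler_norml => /andP[_].
  have : L2 * enorm q ^+ 3 <= L2 * rho ^+ 3.
    by rewrite ler_wpM2l ?(ltW L20)// lerXn2r ?nnegrE ?enorm_ge0 ?(ltW rho0).
  move: (f (x + q)) (f x) (dot (gradient f x) q) (dot (q *m hessian f x) q)
    (L2 * rho ^+ 3) (L2 * enorm q ^+ 3) gq cq => ? ? ? ? ? ? ? ? ? ?; lra.
rewrite /descent_point; case: ifP => [gp|/negbT gp]; first exact: main.
apply: main; rewrite ?enormN// ?dotNr ?mulNmx ?dotNl ?opprK//.
by rewrite oppr_le0 ltW// ltNge.
Qed.

Variables (x : 'rV[R]_d) (M : 'M[R]_d).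
Local Notation g := (gradient f x).
Local Notation A := (hessian f x).
Hypotheses (pM : psd M) (pMA : psd (M - A)).
Hypothesis lM : forall u, l * dot u u <= dot (u *m M) u.
Hypothesis MA4 : forall u, enorm (u *m (M - A)) <= 4 * l * enorm u.

(** [e0] is the error of the model gradient at distance [2 * rho], and [nu] the price of that error
    in [energy_step]. *)
Let e0 : R := 4 * (L2 * rho ^+ 2).
Let nu : R := 2 / (th * l) * e0 ^+ 2.

(* [w] is the total weight of the iterates averaged so far, [vacc] the weighted
   sum of the preconditioned gradients and [t] the sum of the iterates; the
   closed form of [vacc] is the telescoping identity. *)
Definition agd_inv (k : nat) s a (S : R) acc := exists i : nat,
  (i + k)%N = K /\
  [/\ model g A s + 2^-1 * dot (a *m M) a <=
      - (th / 8) * S + th / 4 * dot (a *m M) a + i%:R * nu,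
   dot (s *m M) s <= i%:R * S, dot (a *m M) a <= S & S <= th * B ^+ 2] /\
  exists w (vacc t err : 'rV[R]_d),
  [/\ w + k%:R * (k%:R + 1) / 2 = K%:R * (K%:R + 1) / 2 /\ 0 <= w,
   mnorm M acc <= w * B, mnorm M t <= i%:R * B &
   [/\ w *: g + acc *m A = vacc *m (M - A) + err, enorm err <= w * e0 &
   vacc = - (k%:R *: ((1 - th) *: a + th *: s)) - (1 - th) *: s - th *: t]].

(** Since [th * K%:R = 1], at most [K] steps with [S <= th * B ^+ 2] cannot leave the [M]-ball of
    radius [B]. *)
Lemma agd_inv_bounds k s a S acc : agd_inv k s a S acc ->
  [/\ mnorm M s <= B, mnorm M a <= B & 0 <= S].
Proof.
move=> [i [iK [[_ h2 h3 h4] _]]].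
have B0 := ltW radius_gt0; have th0 := friction_gt0; have th1 := friction_le1.
have S0 : 0 <= S by apply: le_trans h3; exact: pM.2.
have SB : S <= B ^+ 2.
  by rewrite (le_trans h4)// ler_piMl ?sqr_ge0.
split=> //; apply: mnorm_le => //; last exact: le_trans h3 SB.
rewrite (le_trans h2)// (@le_trans _ _ (K%:R * S))//.
  by rewrite ler_wpM2r// ler_nat -iK leq_addr.
by have := ler_wpM2l (ltW K_gt0) h4; rewrite mulrA [_ * th]mulrC frictionK mul1r.
Qed.

Lemma agd_final s a S acc : agd_inv 0 s a S acc ->
  critical (2500 * L2 * rho ^+ 2) f
    (x + (2 / (K%:R * (K%:R + 1))) *: acc).
Proof.
move=> inv; have [sB aB S0] := agd_inv_bounds inv.
have B0 := ltW radius_gt0; have th0 := friction_gt0; have th1 := friction_le1.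
have [i [iK [_ [w [vacc [t [err [[we w0] accB tB [eq errB vE]]]]]]]]] := inv.
rewrite addn0 in iK; subst i.
have w1 : w = K%:R * (K%:R + 1) / 2 by rewrite -we mul0r mul0r addr0.
have wK : K%:R ^+ 2 / 2 <= w by rewrite w1; have := K_gt0; lra.
have wgt0 : 0 < w by apply: lt_le_trans wK; rewrite divr_gt0 ?exprn_gt0.
(* The weights [K], ..., 1 add up to [w], so [z] is a weighted mean of the iterates. *)
have -> : 2 / (K%:R * (K%:R + 1)) = w^-1 by rewrite w1 invf_div.
set z := w^-1 *: acc.
have zr : enorm z <= rho.
  apply: (enorm_le_of_mnorm pM smoothness_gt0 lM).
  rewrite mnormZ ger0_norm ?invr_ge0// -/B.
  by rewrite ler_pdivrMl// mulrC.
have vB : mnorm M vacc <= 2 * B.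
  rewrite vE scale0r oppr0 sub0r.
  rewrite (le_trans (ler_mnormB _ _ pM))// mnormN !mnormZ.
  rewrite !ger0_norm ?subr_ge0 ?(ltW th0)//.
  have h1 : (1 - th) * mnorm M s <= (1 - th) * B by rewrite ler_wpM2l// subr_ge0.
  have h2 : th * mnorm M t <= B.
    by rewrite (le_trans (ler_wpM2l (ltW th0) tB))// mulrA frictionK mul1r.
  have h3 : 0 <= th * B by rewrite mulr_ge0 ?(ltW th0).
  by lra.
have vr : enorm vacc <= 2 * rho.
  apply: (enorm_le_of_mnorm pM smoothness_gt0 lM).
  by rewrite (le_trans vB)// /radius; rewrite mulrCA.
(* The first term is [4 * l] times [2 * rho], divided by [w >= K%:R ^+ 2 / 2]. In units of
   [L2 * rho ^+ 2] the final bound is 2048 from it, 4 from [e0] and 1 from the Taylor remainder at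
   [z]. *)
have gz : enorm (g + z *m A) <= 16 * l * rho / K%:R ^+ 2 + e0.
  have -> : g + z *m A = w^-1 *: (vacc *m (M - A) + err).
    by rewrite -eq scalerDr scalerA mulVf ?gt_eqF// scale1r /z scalemxAl.
  rewrite enormZ ger0_norm ?invr_ge0// ler_pdivrMl// mulrDr.
  rewrite (le_trans (ler_enormD _ _))// lerD//.
  rewrite (le_trans (MA4 _))//.
  have h1 : 4 * l * enorm vacc <= 8 * l * rho.
    have := ler_wpM2l (ltW smoothness_gt0) vr; lra.
  rewrite (le_trans h1)//.
  have -> : w * (16 * l * rho / K%:R ^+ 2) = (16 * l * rho * w) / K%:R ^+ 2.
    by rewrite mulrA [w * _]mulrC.
  rewrite ler_pdivlMr ?exprn_gt0//.
  have h2 : 0 <= l * rho by rewrite mulr_ge0// ltW// smoothness_gt0.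
  have := ler_wpM2l h2 wK; lra.
rewrite /critical.
have := gradient_taylor L20 f2 fL2 x z.
set D := _ - _ - _ => hD.
have -> : gradient f (x + z) = D + (g + z *m A).
  by rewrite /D -[_ - g - _]addrA -opprD subrK.
rewrite (le_trans (ler_enormD _ _))//.
have h : L2 * enorm z ^+ 2 <= L2 * rho ^+ 2.
  by rewrite ler_wpM2l ?(ltW L20)// lerXn2r ?nnegrE ?enorm_ge0 ?(ltW rho0).
have e : 16 * l * rho / K%:R ^+ 2 = 2048 * (L2 * rho ^+ 2).
  by rewrite /smoothness; field; rewrite gt_eqF.
rewrite e in gz.
have : 0 <= L2 * rho ^+ 2 by rewrite mulr_ge0 ?sqr_ge0// ltW.
move: hD gz h; rewrite /e0 -mulrA.
move: (enorm D) (enorm _) (L2 * enorm z ^+ 2) (L2 * rho ^+ 2) => ? ? ? ? ? ? ? ?.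
lra.
Qed.

Lemma curvature_probe p :
  `|dot (gradient f (x + p) - g) p - dot (p *m A) p| <= L2 * enorm p ^+ 3.
Proof.
rewrite -dotNl -dotDl (le_trans (enorm_cauchy _ _))// exprSr mulrA.
by rewrite ler_wpM2r ?enorm_ge0// gradient_taylor.
Qed.

(** The threshold of the curvature test is at least 32 times the error in [curvature_probe], so both
    outcomes of the test are informative. *)
Lemma probe_margin p : enorm p = rho ->
  32 * (L2 * rho ^+ 3) <= th / 4 * dot (p *m M) p.
Proof.
move=> pr; have th0 := friction_gt0.
have h1 : 128 * (L2 * rho ^+ 3) <= th * (l * dot p p).
  rewrite -sqr_enorm pr.
  have -> : 128 * (L2 * rho ^+ 3) = th ^+ 2 * l * rho ^+ 2.
    by rewrite friction_smoothness; ring.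
  rewrite [leRHS]mulrA ler_wpM2r ?sqr_ge0// ler_wpM2r ?(ltW smoothness_gt0)//.
  by rewrite expr2 ler_piMr ?friction_le1// ltW.
by have := ler_wpM2l (ltW th0) (lM p); lra.
Qed.

Lemma rescale0 : rescale rho (0 : 'rV[R]_d) = 0.
Proof. by rewrite /rescale scaler0. Qed.

Lemma probe_neg a : let p := rescale rho a in
  (dot (gradient f (x + p) - g) p < - (th / 4) * dot (p *m M) p) ->
  dot (p *m A) p <= - 4 * (L2 * rho ^+ 3).
Proof.
move=> p; have [a0|a0] := eqVneq (enorm a) 0.
  by rewrite /p (enorm_eq0 a0) rescale0 mul0mx !dot0r mulr0 ltxx.
have pr : enorm p = rho.
  by apply: rescale_norm; rewrite lt_def a0 enorm_ge0.
have := probe_margin pr; have := curvature_probe p; rewrite pr ler_norml.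
have : 0 <= L2 * rho ^+ 3 by rewrite mulr_ge0 ?exprn_ge0 ?ltW.
by move=> h1 /andP[h2 _] h3 h4; lra.
Qed.

(** The probe error is at most another [th / 4] of the form in [M], which doubles the threshold. The
    inequality is homogeneous, so it passes from [p] back to [a]. *)
Lemma probe_nonneg a : let p := rescale rho a in
  - (th / 4) * dot (p *m M) p <= dot (gradient f (x + p) - g) p ->
  - (th / 2) * dot (a *m M) a <= dot (a *m A) a.
Proof.
move=> p; have [a0|a0] := eqVneq (enorm a) 0.
  by rewrite (enorm_eq0 a0) !mul0mx !dot0r mulr0.
have ap : 0 < enorm a by rewrite lt_def a0 enorm_ge0.
have pr : enorm p = rho by apply: rescale_norm.
have := probe_margin pr; have := curvature_probe p; rewrite pr ler_norml.
have : 0 <= L2 * rho ^+ 3 by rewrite mulr_ge0 ?exprn_ge0 ?ltW.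
move=> h1 /andP[_ h2] h3 h4.
have : - (th / 2) * dot (p *m M) p <= dot (p *m A) p by lra.
rewrite /p /rescale; set r := rho / enorm a.
have r0 : 0 < r by rewrite divr_gt0.
rewrite -!scalemxAl !dotZl !dotZr.
rewrite (_ : - (th / 2) * _ = r ^+ 2 * (- (th / 2) * dot (a *m M) a)); last by ring.
by rewrite mulrA -expr2 ler_pM2l ?exprn_gt0.
Qed.

Lemma clip_mnorm c : mnorm M (clip L2 rho K M c) <= B.
Proof.
rewrite /clip; case: ifPn => //; rewrite -ltNge => cB.
have B0 := radius_gt0.
by rewrite mnormZ ger0_norm ?divfK ?gt_eqF ?(lt_trans B0)// divr_ge0 ?mnorm_ge0 ?ltW.
Qed.

Lemma clip_scale c :
  exists2 t, 0 <= t <= 1 & clip L2 rho K M c = t *: c.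
Proof.
rewrite /clip; case: ifPn => [_|]; first by exists 1; rewrite ?scale1r ?lexx ?ler01.
rewrite -ltNge => cB; have B0 := radius_gt0; exists (B / mnorm M c) => //.
by rewrite divr_ge0 ?mnorm_ge0 ?(ltW B0)// ler_pdivrMr ?mul1r ?(ltW cB)// (lt_trans B0).
Qed.

Lemma clip_id c : mnorm M (clip L2 rho K M c) < B -> clip L2 rho K M c = c.
Proof.
rewrite /clip; case: ifPn => //; rewrite -ltNge => cB; have B0 := radius_gt0.
rewrite mnormZ ger0_norm ?divr_ge0 ?mnorm_ge0 ?(ltW B0)//.
by rewrite divfK ?ltxx// gt_eqF// (lt_trans B0).
Qed.

(** The model errors of a whole run stay well below the decrease it must achieve. *)
Lemma nu_total : K%:R * nu = 4^-1 * (L2 * rho ^+ 3).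
Proof.
rewrite /nu /e0 /smoothness /friction; field.
by rewrite !gt_eqF.
Qed.

Lemma nu_ge0 : 0 <= nu.
Proof.
rewrite /nu mulr_ge0 ?sqr_ge0// divr_ge0// mulr_ge0 ?(ltW friction_gt0)//.
exact: ltW smoothness_gt0.
Qed.

Section Step.
Variables (k : nat) (s a : 'rV[R]_d) (S : R) (acc : 'rV[R]_d).
Hypothesis inv : agd_inv k.+1 s a S acc.
Hypothesis curv : - (th / 2) * dot (a *m M) a <= dot (a *m A) a.
Let y := s + (1 - th) *: a.
Let c0 := (1 - th) *: a - gradient f (x + y) *m invmx M.
Let c := clip L2 rho K M c0.
Let S' := S + dot (c *m M) c.

Lemma agd_step_noise : enorm (gradient f (x + y) - g - y *m A) <= e0.
Proof.
have [sB aB _] := agd_inv_bounds inv.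
have th0 := friction_gt0; have th1 := friction_le1; have B0 := radius_gt0.
have yr : enorm y <= 2 * rho.
  apply: (enorm_le_of_mnorm pM smoothness_gt0 lM).
  rewrite mulrCA (le_trans (ler_mnormD _ _ pM))// mnormZ ger0_norm ?subr_ge0//.
  have : (1 - th) * mnorm M a <= mnorm M a.
    by rewrite ler_piMl ?mnorm_ge0//; lra.
  rewrite -/(B); lra.
rewrite (le_trans (gradient_taylor L20 f2 fL2 x y))// /e0 [leRHS]mulrCA.
rewrite ler_wpM2l ?(ltW L20)//.
have -> : 4 * rho ^+ 2 = (2 * rho) ^+ 2 by ring.
by rewrite lerXn2r ?nnegrE ?enorm_ge0// mulr_ge0// ltW.
Qed.

(** [energy_step] releases [th / 4] of the old squared step and charges [th / 8] of the new one.
    Carrying [th / 4] of the latest step makes the balance [th / 8] of [S]. *)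
Lemma agd_step_energy (i : nat) :
  model g A s + 2^-1 * dot (a *m M) a <=
      - (th / 8) * S + th / 4 * dot (a *m M) a + i%:R * nu ->
  model g A (s + c) + 2^-1 * dot (c *m M) c <=
      - (th / 8) * S' + th / 4 * dot (c *m M) c + i.+1%:R * nu.
Proof.
move=> h; have [t t01 ct] := clip_scale c0.
have := energy_step (hessian_sym L20 f2 fL2 x) pM pMA smoothness_gt0 lM
  friction_gt0 friction_le1 t01 agd_step_noise erefl curv ct.
rewrite -/c0 -/c -/nu /S' -[i.+1%:R]natr1.
move: (model g A s) (model g A (s + c)) h => m1 m2 h1 h2; lra.
Qed.

(** In units of [L2 * rho ^+ 3], the energy drops by at least 16, the noise costs at most 1/4, and
    the Taylor remainder at distance [2 * rho] at most 8. *)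
Lemma agd_step_trigger : th * B ^+ 2 <= S' ->
  f (x + (s + c)) <= f x - L2 * rho ^+ 3 /\
  enorm (x + (s + c) - x) <= 2 * rho.
Proof.
move=> trig; have [sB _ _] := agd_inv_bounds inv.
have th0 := friction_gt0; have th1 := friction_le1; have B0 := radius_gt0.
have sr : enorm (s + c) <= 2 * rho.
  apply: (enorm_le_of_mnorm pM smoothness_gt0 lM).
  rewrite mulrCA (le_trans (ler_mnormD _ _ pM))//.
  by have := clip_mnorm c0; rewrite -/c -/(B); lra.
split; last by rewrite addrAC subrr add0r.
have [i [iK [[h1 _ _ _] _]]] := inv.
have h2 := agd_step_energy h1.
have h3 : i.+1%:R * nu <= 4^-1 * (L2 * rho ^+ 3).
  by rewrite -nu_total ler_wpM2r ?nu_ge0// ler_nat -iK addnS ltnS leq_addr.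
have h4 := taylor2 L20 f2 fL2 x (s + c).
have h5 : L2 * enorm (s + c) ^+ 3 <= 8 * (L2 * rho ^+ 3).
  have -> : 8 * (L2 * rho ^+ 3) = L2 * (2 * rho) ^+ 3 by ring.
  by rewrite ler_wpM2l ?(ltW L20)// lerXn2r ?nnegrE ?enorm_ge0// mulr_ge0// ltW.
have h6 : 16 * (L2 * rho ^+ 3) <= th / 8 * S'.
  have -> : 16 * (L2 * rho ^+ 3) = th / 8 * (th * B ^+ 2).
    rewrite sqr_radius.
    have -> : th / 8 * (th * (l * rho ^+ 2)) = 8^-1 * (th ^+ 2 * l * rho ^+ 2).
      by ring.
    by rewrite friction_smoothness; field.
  by rewrite ler_wpM2l// divr_ge0// ltW.
have h7 : 0 <= (1 - th) * dot (c *m M) c by rewrite mulr_ge0 ?subr_ge0// pM.2.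
have h8 : 0 <= dot (c *m M) c by exact: pM.2.
have h9 : 0 <= L2 * rho ^+ 3 by rewrite mulr_ge0 ?exprn_ge0 ?ltW.
move: h2 h3 h4 h5 h6 h7 h8 h9; rewrite /model ler_norml.
move: (f _) (f x) (dot g _) (dot (_ *m A) _) (dot (c *m M) c) (L2 * rho ^+ 3)
  (L2 * _) S' (_ * nu) => ? ? ? ? ? ? ? ? ? h2 h3 /andP[_ h4] h5 h6 h7 h8 h9.
lra.
Qed.

Lemma agd_step_continue : S' < th * B ^+ 2 ->
  agd_inv k (s + c) c S' (acc + k.+1%:R *: (s + c)).
Proof.
move=> cont; have [sB aB S0] := agd_inv_bounds inv.
have th0 := friction_gt0; have th1 := friction_le1; have B0 := radius_gt0.
have [i [iK [[h1 h2 h3 h4] [w [vacc [t [err [[we w0] accB tB [eq errB vE]]]]]]]]] := inv.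
have c_ge0 : 0 <= dot (c *m M) c by exact: pM.2.
(* The squared [M]-norm of [c] is at most [S'], hence below [B ^+ 2]: the truncation is inactive. *)
have cid : c = c0.
  apply: clip_id; rewrite -/c -(@ltr_pXn2r _ 2) ?nnegrE ?mnorm_ge0 ?(ltW B0)//.
  rewrite sqr_mnorm// (@le_lt_trans _ _ S')//; first by rewrite /S'; lra.
  by rewrite (lt_le_trans cont)// ler_piMl// sqr_ge0.
exists i.+1; split; first by rewrite addSnnS.
have scS : dot ((s + c) *m M) (s + c) <= i.+1%:R * S'.
  rewrite /S' -[i.+1%:R]natr1.
  rewrite !bilinE (dot_symC c s pM.1).
  have := psd_cauchy s c pM.
  have : dot (s *m M) s * dot (c *m M) c <= i%:R * S * dot (c *m M) c.
    by rewrite ler_wpM2r.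
  move: (dot (s *m M) s) (dot (s *m M) c) (dot (c *m M) c) h2 c_ge0
    => P X Q h2 Q0 PQ XPQ.
  (* Arithmetic-geometric mean inequality, from [X ^+ 2 <= i%:R * S * Q]. *)
  have : `|2 * X| <= `|S + i%:R * Q|.
    rewrite -ler_sqr ?nnegrE// !real_normK ?num_real//.
    by have := sqr_ge0 (S - i%:R * Q); lra.
  rewrite [X in _ <= X]ger0_norm ?addr_ge0 ?mulr_ge0// ler_norml => /andP[_ hX].
  lra.
have s'B : mnorm M (s + c) <= B.
  apply: mnorm_le => //; first exact: ltW.
  rewrite (le_trans scS)// (@le_trans _ _ (K%:R * S'))//.
    by rewrite ler_wpM2r ?addr_ge0// ler_nat -iK addnS ltnS leq_addr.
  have := ler_wpM2l (ltW K_gt0) (ltW cont).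
  by rewrite mulrA [_ * th]mulrC frictionK mul1r.
split.
  split=> //; [exact: agd_step_energy | by rewrite /S' lerDr | exact: ltW].
set v := (1 - th) *: a - c.
have vM : v *m M = gradient f (x + y).
  by rewrite /v cid /c0 opprB addrC subrK (mulmx_invK smoothness_gt0 lM).
have vE' : c = (1 - th) *: a - v by rewrite /v opprB addrC subrK.
(* The new iterate is [y - v], and the true gradient at [x + y] is [v *m M]; so the model gradient
   at the new iterate is [v *m (M - A)] up to noise. *)
have key : exists2 de, g + (s + c) *m A = v *m (M - A) - de & enorm de <= e0.
  exists (gradient f (x + y) - g - y *m A); last exact: agd_step_noise.
  rewrite mulmxBr vM vE' addrA -/y mulmxBl.
  by apply/rowP => j; rewrite !mxE; ring.
have [de keyE deB] := key.
exists (w + k.+1%:R), (vacc + k.+1%:R *: v), (t + (s + c)), (err - k.+1%:R *: de).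
have k10 : 0 <= k.+1%:R :> R by [].
split; [split| | |split].
- by rewrite -we -natr1; field.
- exact: addr_ge0.
- rewrite (le_trans (ler_mnormD _ _ pM))// mulrDl lerD// mnormZ ger0_norm//.
  by rewrite ler_wpM2l.
- rewrite (le_trans (ler_mnormD _ _ pM))// -natr1 mulrDl lerD//.
  by rewrite mul1r.
- rewrite [(vacc + _) *m _]mulmxDl -[(_ *: v) *m _]scalemxAl addrACA -eq -scalerBr.
  rewrite -keyE [_ *: (g + _)]scalerDr [RHS]addrACA scalerDl; congr (_ + _).
  by rewrite mulmxDl -scalemxAl.
- rewrite (le_trans (ler_enormB _ _))// mulrDl lerD// enormZ ger0_norm//.
  by rewrite ler_wpM2l.
- rewrite vE /v -natr1; apply/rowP => j; rewrite !mxE; ring.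
Qed.

End Step.

Lemma advances_query p next n (m : 'rV[R]_d -> oracle_method 'rV[R]_d) :
  adv (m (gradient f p)) next n x -> adv (Query p m) next n.+1 x.
Proof.
case=> [[h1 h2]|[x' [h1 h2 h3 h4]]]; [left | right]; first by split.
by exists x'.
Qed.

Lemma advances_next next x' n : f x' <= f x - L2 * rho ^+ 3 ->
  enorm (x' - x) <= 2 * rho -> adv (next x') next n x.
Proof. by move=> h1 h2; right; exists x'; split => //; exact: leq_addl. Qed.

(** An iteration makes at most two queries: the curvature probe and the accelerated gradient. *)
Lemma advances_agd next k s a S acc : agd_inv k s a S acc ->
  adv (agd L2 rho K x g M next k s a S acc) next (2 * k) x.
Proof.
elim: k s a S acc => [|k IH] s a S acc inv.
  by left; split => //; exact: agd_final inv.
rewrite mulnS add2n; apply: advances_query => /=; case: ifPn => [hp|].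
  have [] := descent_pointP (rescale_le a) (probe_neg hp).
  exact: advances_next.
rewrite -leNgt => /probe_nonneg curv; apply: advances_query.
case: ifPn => [trig|].
  by have [] := agd_step_trigger inv curv trig; exact: advances_next.
by rewrite -ltNge => cont; apply: IH; exact: agd_step_continue.
Qed.

Lemma agd_inv0 : agd_inv K 0 0 0 0.
Proof.
exists 0%N; split => //; split.
  rewrite /model mul0mx !dot0r !mulr0 !mul0r !addr0; split=> //.
  by rewrite mulr_ge0 ?sqr_ge0// ltW// friction_gt0.
exists 0, 0, 0, 0; rewrite !mnorm0 enorm0 !mul0r; split=> //; first by rewrite add0r.
by split; rewrite ?scale0r ?mul0mx ?addr0// !scaler0 addr0 scaler0 !subr0 oppr0.
Qed.

End PhaseAnalysis.

(** * One phase, given an accurate Hessian estimate *)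

Section EpochAnalysis.
Context {R : realType} {d : nat}.
Variables (f : 'rV[R]_d -> R) (L2 rho : R) (K : nat).
Hypotheses (L20 : 0 < L2) (rho0 : 0 < rho) (K0 : (0 < K)%N).
Hypotheses (f2 : twice_differentiable f) (fL2 : hessian_lipschitz L2 f).
Implicit Types (x u v : 'rV[R]_d) (H : 'M[R]_d)
  (next : 'rV[R]_d -> oracle_method 'rV[R]_d).

Local Notation l := (smoothness L2 rho K).
Local Notation adv := (advances f (2500 * L2 * rho ^+ 2) (L2 * rho ^+ 3) (2 * rho)).

Lemma advances_phase H next x : H^T = H ->
  (forall u v, `|dot (u *m (H - hessian f x)) v| <= l * (enorm u * enorm v)) ->
  adv (phase L2 rho K H next x) next (2 * K).+1 x.
Proof.
move=> HT HA; rewrite /phase; apply: advances_query.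
have l0 := smoothness_gt0 L20 rho0 K0.
set P := [set u | _]%classic; set u := xget 0 P.
have HAu w : dot (w *m hessian f x) w <= dot (w *m H) w + l * dot w w.
  have := HA w w; rewrite mulmxBr !bilinE -expr2 sqr_enorm ler_norml => /andP[].
  by move: (dot _ _) (dot _ _) (dot _ _) => ? ? ?; lra.
case: ifPn => [hu|].
  have u0 : 0 < enorm u.
    rewrite lt_def enorm_ge0 andbT; apply/eqP => u0.
    by move: hu; rewrite (enorm_eq0 u0) mul0mx !dot0r mulr0 ltxx.
  have [] := @descent_pointP _ _ f L2 rho L20 rho0 f2 fL2 x (rescale rho u)
    (rescale_le rho0 u).
    have := HAu u; move: hu.
    rewrite /rescale; set r := rho / enorm u.
    have : r ^+ 2 * dot u u = rho ^+ 2.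
      by rewrite -sqr_enorm -exprMn divfK// gt_eqF.
    have r0 : 0 < r ^+ 2 by rewrite exprn_gt0// divr_gt0.
    rewrite -!scalemxAl !dotZl !dotZr mulrA -expr2.
    move=> ru hu hA.
    (* Curvature below [- 2 * l] for [H] is below [- l] for the true Hessian; at length [rho] this
       far exceeds what [descent_pointP] needs. *)
    have : r ^+ 2 * dot (u *m hessian f x) u <= r ^+ 2 * (- l * dot u u).
      by rewrite ler_pM2l//; lra.
    move/le_trans; apply.
    rewrite mulrCA ru /smoothness.
    have K1 : 1 <= K%:R ^+ 2 :> R by rewrite exprn_ege1// ler1n.
    have : 0 <= L2 * rho ^+ 3 by rewrite mulr_ge0 ?exprn_ge0 ?ltW.
    by move=> h; have := ler_wpM2l h K1; lra.
  by move=> h1 h2; apply: advances_next.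
rewrite -leNgt => hu.
have Hpos w : - (2 * l) * dot w w <= dot (w *m H) w.
  rewrite leNgt; apply/negP => hw; move: hu; apply/negP; rewrite -ltNge.
  exact: (xgetI 0 (P := P) hw).
(* [H >= - 2 * l] makes [M >= l], and an estimation error of at most [l] puts [M - hessian f x]
   between [2 * l] and [4 * l]. *)
set M := H + _.
have ME w v : dot (w *m M) v = dot (w *m H) v + 3 * l * dot w v.
  by rewrite /M mulmxDr mul_mx_scalar !bilinE.
have pM : psd M.
  split; first by rewrite /M linearD/= tr_scalar_mx HT.
  move=> w; rewrite ME; have := Hpos w.
  by have := mulr_ge0 (ltW l0) (dot_ge0 w); lra.
have MAE w v : dot (w *m (M - hessian f x)) v =
    dot (w *m (H - hessian f x)) v + 3 * l * dot w v.
  by rewrite !mulmxBr !(dotDl, dotNl) ME; ring.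
apply: advances_agd => //.
- split; first by rewrite linearB/= pM.1 (hessian_sym L20 f2 fL2).
  move=> w; rewrite MAE; have := HA w w.
  rewrite -expr2 sqr_enorm ler_norml => /andP[h _].
  by have := mulr_ge0 (ltW l0) (dot_ge0 w); lra.
- by move=> w; rewrite ME; have := Hpos w; lra.
- move=> w; apply: enorm_le_dot => [|v].
    by rewrite !mulr_ge0 ?enorm_ge0// ltW.
  rewrite MAE; have := HA w v; have := enorm_cauchy w v.
  rewrite !ler_norml => /andP[_ h1] /andP[_ h2].
  by have := ler_wpM2l (ltW l0) h1; lra.
exact: agd_inv0.
Qed.

End EpochAnalysis.

(** * Hessian estimation and the chaining of phases and epochs *)

Section Epochs.
Context {R : realType} {d : nat}.
Local Notation V := 'rV[R]_d.
Implicit Types (x u v : V) (H : 'M[R]_d) (next : V -> oracle_method V).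

Fixpoint ask (ps : seq V) (cont : seq V -> oracle_method V) :=
  if ps is p :: ps' then Query p (fun v => ask ps' (fun vs => cont (v :: vs)))
  else cont [::].

Lemma output_ask (G : V -> V) ps cont :
  output G (ask ps cont) = output G (cont (map G ps)).
Proof. by elim: ps cont => //= p ps IH cont; rewrite IH. Qed.

Lemma queries_ask (G : V -> V) ps cont :
  queries G (ask ps cont) = (size ps + queries G (cont (map G ps)))%N.
Proof. by elim: ps cont => //= p ps IH cont; rewrite IH. Qed.

Variables (L2 rho : R) (K : nat).

Fixpoint phases (t : nat) H next x :=
  if t is t'.+1 then phase L2 rho K H (phases t' H next) x else next x.

(* The [d ^ 2] entries of the estimate are each accurate to [L2 * step]. *)
Definition step : R := rho / d%:R ^+ 2.

(** Forward differences, with the gradient at [x] at index 0. They are symmetrized because the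
    preconditioner must be symmetric; as the true Hessian is symmetric, this does not increase the
    error bound. *)
Definition estimate x (vs : seq V) : 'M[R]_d :=
  let N := \matrix_(i < d, j < d) (step^-1 * (vs`_i.+1 - vs`_0) 0 j) in
  2^-1 *: (N + N^T).

Definition probes x := x :: [seq x + step *: delta_mx 0 i | i <- enum 'I_d].

Definition epoch next x : oracle_method V :=
  ask (probes x) (fun vs => phases (32 * K ^ 2) (estimate x vs) next x).

Fixpoint epochs (E : nat) x : oracle_method V :=
  if E is E'.+1 then epoch (epochs E') x else Output x.

Definition epoch_cost : nat := d.+1 + 32 * K ^ 2 * (2 * K).+1.

Variable f : V -> R.
Hypotheses (L20 : 0 < L2) (rho0 : 0 < rho) (K0 : (0 < K)%N) (d0 : (0 < d)%N).
Hypotheses (f2 : twice_differentiable f) (fL2 : hessian_lipschitz L2 f).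

Local Notation l := (smoothness L2 rho K).
Local Notation adv := (advances f (2500 * L2 * rho ^+ 2)).

Lemma mulSnr (n : nat) (a : R) : n.+1%:R * a = a + n%:R * a.
Proof. by rewrite -natr1 mulrDl mul1r addrC. Qed.

(** Decreases, displacements and query counts add up; the second guarantee is required only where
    the first part can end. *)
Lemma advances_trans p1 p2 r1 r2 m next1 next2 n1 n2 x :
  adv p1 r1 m next1 n1 x ->
  (forall x', enorm (x' - x) <= r1 -> adv p2 r2 (next1 x') next2 n2 x') ->
  adv (p1 + p2) (r1 + r2) m next2 (n1 + n2) x.
Proof.
move=> [[h1 h2] _|[x' [h1 h2 h3 h4]] /(_ _ h4)].
  by left; split => //; rewrite (leq_trans h2)// leq_addr.
case=> [[g1 g2]|[x'' [g1 g2 g3 g4]]]; [left|right].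
  by rewrite h1; split => //; rewrite (leq_trans h2)// leq_add2l.
exists x''; rewrite h1 g1; split => //.
- by rewrite (leq_trans h2)// -addnA leq_add2l.
- by rewrite (le_trans g3)// opprD addrA lerD2r.
- rewrite -(subrK x' x'') -addrA (le_trans (ler_enormD _ _))//.
  by rewrite [r1 + r2]addrC lerD.
Qed.

Lemma step_gt0 : 0 < step.
Proof. by rewrite divr_gt0// exprn_gt0// ltr0n. Qed.

Lemma enorm_le_entries u c : 0 <= c -> (forall i, `|u 0 i| <= c) ->
  enorm u <= d%:R * c.
Proof.
move=> c0 uc; rewrite [u in enorm u]row_sum_delta.
rewrite (le_trans (enorm_sum _))// mulr_natl -[X in _ *+ X](card_ord d).
rewrite -sumr_const ler_sum// => i _.
by rewrite enormZ enorm_delta mulr1.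
Qed.

Lemma nth_probes (G : V -> V) x (i : 'I_d) :
  (map G (probes x))`_i.+1 = G (x + step *: delta_mx 0 i).
Proof.
rewrite /probes map_cons -[LHS]/(nth 0 (map G _) i).
rewrite (nth_map 0); last by rewrite size_map size_enum_ord.
by rewrite (nth_map i) ?size_enum_ord// nth_ord_enum.
Qed.

(** Summing crudely over the entries loses a factor [d ^ 2], which is absorbed by [step] and costs
    no query. *)
Lemma estimateP x : let H := estimate x (map (gradient f) (probes x)) in
  H^T = H /\ forall u v,
    `|dot (u *m (H - hessian f x)) v| <= L2 * rho * (enorm u * enorm v).
Proof.
move=> H; rewrite /H /estimate; set N := \matrix_(i, j) _.
have h0 := step_gt0.
have NE i j : `|N i j - hessian f x i j| <= L2 * step.
  have -> : N i j = step^-1 *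
      (gradient f (x + step *: delta_mx 0 i) - gradient f x) 0 j.
    by rewrite mxE nth_probes.
  have -> : hessian f x i j =
      step^-1 * ((step *: (delta_mx 0 i : V)) *m hessian f x) 0 j.
    move: (hessian f x) => J; rewrite -scalemxAl -rowE mxE.
    rewrite [row i J _ _]mxE mulKf ?gt_eqF//.
  have := gradient_taylor L20 f2 fL2 x (step *: delta_mx 0 i).
  move/(le_trans (normr_le_enorm _ j)).
  rewrite enormZ enorm_delta mulr1 (ger0_norm (ltW h0)).
  move: (gradient f _ - _) (_ *m hessian f x) => D J.
  rewrite [(D - J) 0 j]mxE [(- J) 0 j]mxE -mulrBr => h.
  rewrite normrM ger0_norm ?invr_ge0 ?(ltW h0)// ler_pdivrMl//.
  by rewrite (le_trans h)// expr2 mulrCA.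
split; first by rewrite linearZ/= linearD/= trmxK addrC.
move=> u v.
have HE i j : `|(2^-1 *: (N + N^T) - hessian f x) i j| <= L2 * step.
  have := NE i j; have := NE j i.
  have -> : hessian f x j i = hessian f x i j.
    by rewrite -[in LHS](hessian_sym L20 f2 fL2 x) mxE.
  have symE (P J : 'M[R]_d) :
      (2^-1 *: (P + P^T) - J) i j = 2^-1 * (P i j + P j i) - J i j.
    by rewrite !mxE.
  rewrite symE; move: (N i j) (N j i) (hessian f x i j) (L2 * step) => ? ? ? ?.
  rewrite !ler_norml => /andP[? ?] /andP[? ?]; apply/andP; split; lra.
rewrite (le_trans (enorm_cauchy _ _))// mulrA ler_wpM2r ?enorm_ge0//.
rewrite (le_trans (enorm_mulmx_le _ _))// mulrC ler_wpM2r ?enorm_ge0//.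
have -> : L2 * rho = \sum_(i < d) d%:R * (L2 * step).
  rewrite sumr_const card_ord /step -mulr_natl; field.
  by rewrite pnatr_eq0 -lt0n.
rewrite ler_sum// => i _; apply: enorm_le_entries.
  by rewrite mulr_ge0// ltW.
by move=> j; rewrite mxE.
Qed.

Lemma smoothness_margin : L2 * rho + L2 * (64 * rho * K%:R ^+ 2) <= l.
Proof.
have K1 : 1 <= K%:R ^+ 2 :> R by rewrite exprn_ege1// ler1n.
have Lr : 0 <= L2 * rho by rewrite mulr_ge0// ltW.
have := ler_wpM2l Lr K1; have := mulr_ge0 Lr (le_trans ler01 K1).
by rewrite /smoothness; lra.
Qed.

(** [H] was estimated at [z], and [t] of [T] phases remain. Those already done moved at most
    [64 * rho * K%:R ^+ 2], so the drift of the Hessian and the estimation error together fit into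
    [l] by [smoothness_margin]. *)
Lemma advances_phases T t H next z x : H^T = H ->
  (forall u v,
    `|dot (u *m (H - hessian f z)) v| <= L2 * rho * (enorm u * enorm v)) ->
  T%:R <= 32 * K%:R ^+ 2 :> R -> (t <= T)%N ->
  enorm (x - z) <= 2 * rho * (T%:R - t%:R) ->
  adv (t%:R * (L2 * rho ^+ 3)) (t%:R * (2 * rho)) (phases t H next x) next
    (t * (2 * K).+1) x.
Proof.
move=> HT HE TK; elim: t x => [|t IH] x tT xz.
  rewrite /= !mul0r; right; exists x; split => //.
  - by rewrite subr0.
  - by rewrite subrr enorm0.
rewrite ![t.+1%:R * _]mulSnr [(t.+1 * _)%N]mulSn.
apply: (@advances_trans _ _ _ _ _ (phases t H next)) => [|x' x'x]; last first.
  apply: IH; first exact: ltnW.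
  have -> : x' - z = (x' - x) + (x - z) by rewrite addrA subrK.
  rewrite (le_trans (ler_enormD _ _))//; move: x'x xz; rewrite -[t.+1%:R]natr1.
  by move: (enorm (x' - x)) (enorm (x - z)) => ? ? ? ?; lra.
rewrite [phases _ _ _ _]/=.
apply: (advances_phase L20 rho0 K0 f2 fL2 _ HT) => u v.
have xz' : enorm (z - x) <= 64 * rho * K%:R ^+ 2.
  rewrite -enormN opprB (le_trans xz)//.
  have : 0 <= rho * t.+1%:R by rewrite mulr_ge0 ?(ltW rho0).
  have := ler_wpM2l (ltW rho0) TK; lra.
have -> : H - hessian f x = (H - hessian f z) + (hessian f z - hessian f x).
  by rewrite addrA subrK.
rewrite mulmxDr dotDl (le_trans (ler_normD _ _))//.
have h1 := HE u v.
have h2 : `|dot (u *m (hessian f z - hessian f x)) v| <=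
    L2 * (64 * rho * K%:R ^+ 2) * (enorm u * enorm v).
  rewrite (le_trans (enorm_cauchy _ _))// mulrA ler_wpM2r ?enorm_ge0//.
  rewrite (le_trans (opnorm_ub _ _))// ler_wpM2r ?enorm_ge0//.
  by rewrite (le_trans (fL2 _ _))// ler_wpM2l ?(ltW L20).
rewrite (le_trans (lerD h1 h2))// -mulrDl ler_wpM2r ?mulr_ge0 ?enorm_ge0//.
exact: smoothness_margin.
Qed.

Lemma advances_epoch next x :
  adv ((32 * K ^ 2)%N%:R * (L2 * rho ^+ 3)) ((32 * K ^ 2)%N%:R * (2 * rho))
    (epoch next x) next epoch_cost x.
Proof.
have [HT HE] := estimateP x.
have TK : (32 * K ^ 2)%N%:R <= 32 * K%:R ^+ 2 :> R by rewrite natrM natrX.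
have := @advances_phases _ _ _ next x x HT HE TK (leqnn _).
rewrite !subrr enorm0 mulr0 => /(_ (lexx 0)).
have sz : size (probes x) = d.+1 by rewrite /= size_map size_enum_ord.
rewrite /advances /epoch output_ask queries_ask sz /epoch_cost.
case=> [[h1 h2]|[x' [h1 h2 h3 h4]]]; [left|right].
  by split=> //; rewrite leq_add2l.
by exists x'; split => //; rewrite -addnA leq_add2l.
Qed.

Lemma advances_epochs E x :
  adv (E%:R * ((32 * K ^ 2)%N%:R * (L2 * rho ^+ 3)))
    (E%:R * ((32 * K ^ 2)%N%:R * (2 * rho)))
    (epochs E x) (@Output _) (E * epoch_cost) x.
Proof.
elim: E x => [|E IH] x.
  rewrite !mul0r; right; exists x; split => //; first by rewrite subr0.
  by rewrite subrr enorm0.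
rewrite ![E.+1%:R * _]mulSnr [(E.+1 * _)%N]mulSn.
by apply: advances_trans (advances_epoch _ _) (fun x' _ => IH x').
Qed.

End Epochs.

Lemma suboptimality_gap (R : realType) (d : nat) (Delta : R)
  (f : 'rV[R]_d -> R) x0 y :
  bounded_suboptimality Delta f x0 -> f x0 - f y <= Delta.
Proof.
rewrite /bounded_suboptimality => h.
have : (ereal_inf (range (EFin \o f)) <= (f y)%:E)%E.
  by apply: ereal_inf_lbound; exists y.
(* An infimum [+oo] contradicts the lower bound property, and [-oo] contradicts bounded
   sub-optimality. *)
move: h; case: (ereal_inf _) => [r| |] //=.
by rewrite -EFinB !lee_fin => h1 h2; lra.
Qed.

(** * Choice of the parameters and the query count *)

Section QueryCount.
Context {R : realType}.

(** The phases of an epoch cost on the order of [K ^ 3] queries; this choice balances them with the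
    [d + 1] queries for the Hessian. *)
Definition block_size (d : nat) : nat := (Num.truncn (d%:R `^ (1 / 3) : R)).+1.

(* [2500 * L2 * scale ^+ 2 = eps]; the output is 2053 L2 rho^2-critical. *)
Definition scale (L2 eps : R) : R := Num.sqrt eps / (50 * Num.sqrt L2).

(** The successor makes the total guaranteed decrease strictly larger than [Delta]. *)
Definition epoch_count (d : nat) (L2 Delta eps : R) : nat :=
  (Num.truncn (Delta / ((32 * block_size d ^ 2)%N%:R *
     (L2 * scale L2 eps ^+ 3)))).+1.

Lemma block_sizeP d : (0 < d)%N ->
  d%:R `^ (1 / 3) <= (block_size d)%:R :> R /\
  (block_size d)%:R <= 2 * d%:R `^ (1 / 3) :> R.
Proof.
move=> d0; set q := _ `^ _.
have q1 : 1 <= q.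
  have -> : 1 = 1 `^ (1 / 3) :> R by rewrite powR1.
  by rewrite ge0_ler_powR ?nnegrE ?divr_ge0// ler1n.
have /andP[h1 h2] := truncn_itv (le_trans ler01 q1).
split; first exact: ltW.
by rewrite /block_size -natr1 -/q; lra.
Qed.

Lemma cube_root_cube (d : nat) : (d%:R `^ (1 / 3)) ^+ 3 = d%:R :> R.
Proof.
rewrite -powR_mulrn ?powR_ge0// -powRrM.
by rewrite (_ : 1 / 3 * 3%:R = 1) ?powRr1//; field.
Qed.

Lemma scale_gt0 (L2 eps : R) : 0 < L2 -> 0 < eps -> 0 < scale L2 eps.
Proof. by move=> L20 e0; rewrite divr_gt0 ?mulr_gt0 ?sqrtr_gt0. Qed.

Lemma scale_sqr (L2 eps : R) : 0 < L2 -> 0 < eps ->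
  2500 * L2 * scale L2 eps ^+ 2 = eps.
Proof.
move=> L20 e0; rewrite /scale exprMn exprVn exprMn !sqr_sqrtr ?ltW//.
by field; rewrite gt_eqF.
Qed.

Lemma scale_cube (L2 eps : R) : 0 < L2 -> 0 < eps ->
  (L2 * scale L2 eps ^+ 3)^-1 = 50 ^+ 3 * (L2 `^ (1 / 2) * eps `^ (- (3 / 2))).
Proof.
move=> L20 e0; rewrite div1r powR12_sqrt ?ltW//.
have -> : eps `^ (- (3 / 2)) = (Num.sqrt eps ^+ 3)^-1.
  rewrite powRN -powR12_sqrt ?ltW// -powR_mulrn ?powR_ge0// -powRrM.
  by congr (_ `^ _)^-1; field.
rewrite /scale -{1}[L2](sqr_sqrtr (ltW L20)).
by field; rewrite !gt_eqF ?sqrtr_gt0.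
Qed.

Lemma epoch_costE d K : (@epoch_cost d K)%:R =
  d%:R + 1 + 32 * K%:R ^+ 2 * (2 * K%:R + 1) :> R.
Proof.
rewrite /epoch_cost -[d.+1]addn1 -[(2 * K).+1]addn1 !natrD !natrM expr2.
by rewrite natrD natrM.
Qed.

Lemma query_bound (d : nat) (L2 Delta eps : R) :
  (0 < d)%N -> 0 < L2 -> 0 < Delta -> 0 < eps ->
  (epoch_count d L2 Delta eps * @epoch_cost d (block_size d))%:R <=
  770 * 50 ^+ 3 * (d%:R `^ (1 / 3) * L2 `^ (1 / 2) * Delta * eps `^ (- (3 / 2))
    + d%:R).
Proof.
move=> d0 L20 D0 e0; rewrite natrM.
set q := d%:R `^ (1 / 3).
have [qK Kq] := block_sizeP d0; rewrite -/q in qK Kq.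
set K := block_size d in qK Kq *.
have q1 : 0 < q by rewrite powR_gt0// ltr0n.
have qd : q ^+ 3 = d%:R by exact: cube_root_cube.
have K1 : 1 <= K%:R :> R by rewrite ler1n.
have dd : 1 <= d%:R :> R by rewrite ler1n.
(* At most [2 * d] for the Hessian and [96 * K ^ 3 <= 768 * d] for the phases. *)
have cost : (@epoch_cost d K)%:R <= 770 * d%:R :> R.
  rewrite epoch_costE.
  have K3 : K%:R ^+ 3 <= 8 * d%:R :> R.
    have -> : 8 * d%:R = (2 * q) ^+ 3 by rewrite -qd; ring.
    by rewrite lerXn2r ?nnegrE// mulr_ge0// ltW.
  have : K%:R ^+ 2 <= K%:R ^+ 3 :> R by rewrite ler_weXn2l.
  lra.
set Y := L2 * scale L2 eps ^+ 3.
have Y0 : 0 < Y by rewrite mulr_gt0// exprn_gt0// scale_gt0.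
have count : (epoch_count d L2 Delta eps)%:R <= Delta / (32 * q ^+ 2 * Y) + 1.
  rewrite /epoch_count -/K -/Y -natr1 lerD2r.
  have T0 : 0 < (32 * K ^ 2)%N%:R * Y by rewrite mulr_gt0// ltr0n muln_gt0 expn_gt0.
  have DT : 0 <= Delta / ((32 * K ^ 2)%N%:R * Y) by rewrite divr_ge0 ?ltW.
  have /andP[+ _] := truncn_itv DT; move/le_trans; apply.
  have q0 : 0 < 32 * q ^+ 2 * Y by rewrite mulr_gt0// mulr_gt0// exprn_gt0.
  rewrite ler_wpM2l ?(ltW D0)// lef_pV2 ?posrE// ler_wpM2r ?(ltW Y0)//.
  by rewrite natrM natrX ler_wpM2l// lerXn2r ?nnegrE// ltW.
have Ye : Y^-1 = 50 ^+ 3 * (L2 `^ (1 / 2) * eps `^ (- (3 / 2))).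
  exact: scale_cube.
set X := q * L2 `^ (1 / 2) * Delta * eps `^ (- (3 / 2)).
have X0 : 0 <= X by rewrite !mulr_ge0 ?powR_ge0 ?ltW.
(* With [d = q ^+ 3], dividing by [q ^+ 2] leaves the factor [q], the cube root of the dimension. *)
have prod : Delta / (32 * q ^+ 2 * Y) * d%:R = 50 ^+ 3 / 32 * X.
  rewrite -qd invfM Ye /X; move: (L2 `^ _) (eps `^ _) => ? ?.
  by field; rewrite gt_eqF.
rewrite (le_trans (ler_pM _ _ count cost))//.
rewrite mulrCA [(_ + 1) * _]mulrDl mul1r prod.
by lra.
Qed.

End QueryCount.

Theorem corollary1 (R : realType) :
  exists (C : R) (k : nat)
    (method : forall d : nat, R -> R -> R -> R -> 'rV[R]_d ->
                oracle_method 'rV[R]_d),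
  forall (d : nat) (L1 L2 Delta : R) (f : 'rV[R]_d -> R)
    (x0 : 'rV[R]_d) (eps : R),
  (1 <= d)%N -> 0 < L1 -> 0 < L2 -> 0 < Delta ->
  twice_differentiable f ->
  gradient_lipschitz L1 f ->
  hessian_lipschitz L2 f ->
  bounded_suboptimality Delta f x0 ->
  0 < eps ->
  eps <= Num.min (L1 ^+ 2 * L2^-1) (Delta `^ (2 / 3) * L2 `^ (1 / 3)) ->
  critical eps f (output (gradient f) (method d L1 L2 Delta eps x0)) /\
  (queries (gradient f) (method d L1 L2 Delta eps x0))%:R <=
    C * polylog k L2 Delta eps *
    (d%:R `^ (1 / 3) * L2 `^ (1 / 2) * Delta * eps `^ (- (3 / 2)) + d%:R).
Proof.
exists (770 * 50 ^+ 3), 0%N, (fun d L1 L2 Delta eps x =>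
  epochs L2 (scale L2 eps) (@block_size R d) (epoch_count d L2 Delta eps) x).
move=> d L1 L2 Delta f x0 eps d0 _ L20 D0 f2 _ fL2 sub e0 _.
rewrite /polylog expr0 mulr1.
have r0 := scale_gt0 L20 e0.
have count := query_bound d0 L20 D0 e0.
have := @advances_epochs _ _ L2 (scale L2 eps) (@block_size R d) f L20 r0 isT
  d0 f2 fL2 (epoch_count d L2 Delta eps) x0.
rewrite /advances scale_sqr//; case=> [[h1 h2]|[x' [_ _ drop _]]].
  by split=> //; rewrite (le_trans _ count)// ler_nat.
(* In the remaining case every phase decreased [f], by more than [Delta] in total, which bounded
   sub-optimality forbids. *)
have gap := suboptimality_gap x' sub.
suff : Delta < (epoch_count d L2 Delta eps)%:R *
   ((32 * block_size (R := R) d ^ 2)%N%:R * (L2 * scale L2 eps ^+ 3)) by lra.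
rewrite -ltr_pdivrMr; last first.
  by rewrite mulr_gt0 ?ltr0n ?muln_gt0 ?expn_gt0// mulr_gt0// exprn_gt0.
by rewrite real_truncnS_gt ?num_real.
Qed.
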